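(* Let $n\ge 1$. The NBC sets of the Shi arrangement in dimension $n$ are in one-to-one correspondence with the labelled trees on $n+1$ vertices.
   Context: The Shi arrangement in dimension $n$ is the arrangement in $\mathbb{R}^n$ of all hyperplanes $x_j-x_i=g$ with $1\le i<j\le n$ and $g\in\{0,1\}$. It corresponds to the Shi gain graph $S_n=K_n^{01}$: the graph on vertex set $\{1,\dots,n\}$ having, for each $i<j$ and each $g\in\{0,1\}$, an edge $g(i,j)$ whose gain is $g$ when oriented from $i$ to $j$ and $-g$ when oriented from $j$ to $i$. A circle is (the edge set of) a connected 2-regular subgraph (two parallel edges form a circle of length 2); its gain is the sum of the gains of its edges taken in a cyclic direction, and it is balanced if its gain is $0$. An edge set is balanced if every circle contained in it is balanced. Fix a linear order on the edges of $S_n$. A broken circuit is a set of edges obtained from a balanced circle by deleting its smallest edge. An NBC set of the Shi arrangement is a balanced set of edges of $S_n$ that contains no broken circuit (the number of NBC sets does not depend on the chosen linear order). A labelled tree on $n+1$ vertices is an (unrooted) tree whose vertex set is a fixed set of $n+1$ labels. *)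

(* Defs.v *)
From mathcomp Require Import all_boot all_order all_algebra.

Set Implicit Arguments.
Unset Strict Implicit.
Unset Printing Implicit Defensive.

Import GRing.Theory.

Section Multigraph.

(* A loopless multigraph with vertex set V is given by its edges E and the
   two-element set of endpoints of each edge; an edge set A : {set E} stands for
   the subgraph of the same name. *)
Variables (V E : finType) (ends : E -> {set V}).
Implicit Types (A C : {set E}) (u v : V).

Definition degree A v : nat := #|[set e in A | v \in ends e]|.

Definition adjacent A : rel V :=
  [rel u v | [exists e in A, ends e == [set u; v]]].

(* The vertices of the subgraph are those of positive degree. *)
Definition circle C : bool :=
  [&& C != set0,
      [forall v, (0 < degree C v) ==> (degree C v == 2)] &
      [forall u, forall v,
         (0 < degree C u) && (0 < degree C v) ==> connect (adjacent C) u v]].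

End Multigraph.

(* Edges of the Shi gain graph: ((i, j), b) with i < j is the edge g(i, j) whose
   gain from i to j is g = b. Vertices are numbered from 0 to n - 1. *)
Definition shi_edge (n : nat) : Type :=
  {e : 'I_n * 'I_n * bool | e.1.1 < e.1.2}.

Section Shi.

Variable n : nat.
Implicit Types (e f : shi_edge n) (A B C D : {set shi_edge n}).

Definition lower e : 'I_n := (val e).1.1.
Definition upper e : 'I_n := (val e).1.2.
Definition shi_ends e : {set 'I_n} := [set lower e; upper e].
Definition gain e : int := ((val e).2 : nat)%:Z.

(* A set D encodes an orientation: the edges in D are taken from lower to upper,
   all others from upper to lower. *)
Definition source D e : 'I_n := if e \in D then lower e else upper e.
Definition target D e : 'I_n := if e \in D then upper e else lower e.

(* On a circle C, this says that each vertex of C is the source of one of its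
   two edges and the target of the other. *)
Definition cyclic_direction D C : bool :=
  [forall v, #|[set e in C | source D e == v]|
               == #|[set e in C | target D e == v]|].

Definition gain_along D C : int :=
  (\sum_(e in C) (if e \in D then gain e else - gain e))%R.

(* A circle has two cyclic directions, and reversing the direction negates the
   gain, so that it does not matter which one is taken. *)
Definition balanced_circle C : bool :=
  circle shi_ends C &&
  [exists D, cyclic_direction D C && (gain_along D C == 0%R)].

Definition balanced A : bool :=
  [forall C : {set shi_edge n},
     (C \subset A) && circle shi_ends C ==> balanced_circle C].

Definition broken_circuit (le : rel (shi_edge n)) B : bool :=
  [exists C : {set shi_edge n}, exists e in C,
     [&& balanced_circle C, [forall f in C, le e f] & B == C :\ e]].

Definition nbc_set (le : rel (shi_edge n)) A : bool :=
  balanced A &&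
  [forall B : {set shi_edge n}, broken_circuit le B ==> ~~ (B \subset A)].

End Shi.

(* T is the edge set of a tree on all of V; simple graphs are represented by sets
   of two-element sets of vertices. *)
Definition is_tree (V : finType) (T : {set {set V}}) : bool :=
  [&& [forall e in T, #|e| == 2],
      [forall u, forall v, connect (adjacent id T) u v] &
      [forall C : {set {set V}}, (C \subset T) ==> ~~ circle id C]].

(* Main.v *)
Require Import Defs.
From mathcomp Require Import all_boot all_order all_algebra.
From mathcomp Require Import fingroup perm zify.

(* Both sets have (n + 1)^(n - 1) elements.

   Trees on n + 1 vertices, rooted at 0, are parent maps all of whose orbits
   reach the root. Expanding the determinant of (n + 1) I - J, of size n, row by
   row over all parent maps p gives a sum of determinants, each equal to 1 if p
   reaches the root everywhere and to 0 otherwise.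

   For NBC sets, colour the vertices by the integers modulo q and call an edge
   of gain g from i to j satisfied if x_j - x_i = g. By inclusion-exclusion the
   number of colourings satisfying no edge is an alternating sum over edge sets
   A. Those A that contain a broken circuit cancel in pairs (toggle the largest
   edge that completes a broken circuit of A), and for q large unbalanced sets
   are never satisfied; an NBC set A has no circle, so that q^(n - |A|)
   colourings satisfy it. On the other hand this number is q (q - n)^(n - 1).
   The resulting polynomial identity is evaluated at q = -1. *)

Set Implicit Arguments.
Unset Strict Implicit.
Unset Printing Implicit Defensive.

Import Order.TTheory GRing.Theory Num.Theory.

(** * Circles in multigraphs *)

Lemma sum_nat_pred (T : finType) (A : {set T}) (Q : pred T) :
  \sum_(x in A) Q x = #|[set x in A | Q x]|.
Proof.
rewrite -sum1_card big_mkcond [RHS]big_mkcond; apply: eq_bigr => x _.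
by rewrite inE; case: (x \in A); case: (Q x).
Qed.

Section Multigraph.

Variables (V E : finType) (ends : E -> {set V}).
Implicit Types (A C P : {set E}) (e : E) (u v w : V).

Lemma degreeE A v : degree ends A v = \sum_(e in A) (v \in ends e).
Proof. by rewrite sum_nat_pred. Qed.

Lemma degreeU1 e A v : e \notin A ->
  degree ends (e |: A) v = (v \in ends e) + degree ends A v.
Proof. by move=> eA; rewrite !degreeE big_setU1. Qed.

Lemma degree_gt0 A v e : e \in A -> v \in ends e -> 0 < degree ends A v.
Proof. by move=> eA ve; apply/card_gt0P; exists e; rewrite inE eA. Qed.

Lemma adjacent_sym A : symmetric (adjacent ends A).
Proof. by move=> u v; apply: eq_existsb => e; rewrite setUC. Qed.

Lemma adjacentI A e u v : e \in A -> ends e = [set u; v] -> adjacent ends A u v.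
Proof. by move=> eA uv; apply/existsP; exists e; rewrite eA uv eqxx. Qed.

Lemma connect_adjacent_subset A C u v : A \subset C ->
  connect (adjacent ends A) u v -> connect (adjacent ends C) u v.
Proof.
move=> sAC; apply: connect_sub => x y /existsP[e /andP[eA /eqP xy]].
by apply/connect1/(adjacentI (subsetP sAC _ eA)).
Qed.

(** An inner vertex of a simple path meets two of its edges and each end lacks one. Adding the two
    end terms also covers the one-vertex path, where both fall on [u] and [P] is empty. *)
Lemma path_edges A u p :
    path (adjacent ends A) u p -> uniq (u :: p) ->
  exists P, [/\ P \subset A,
    forall w, degree ends P w + (w == u) + (w == last u p)
              = (w \in u :: p).*2
  & forall w, w \in u :: p -> connect (adjacent ends P) u w].
Proof.
elim: p u => [|v p IHp] u /=.
  move=> _ _; exists set0; split; first exact: sub0set.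
    by move=> w; rewrite degreeE big_set0 inE addnn.
  by move=> w; rewrite inE => /eqP ->.
case/andP=> /existsP[e /andP[eA /eqP def_e]] path_p /andP[u_p uniq_p].
have [P [sPA degP conP]] := IHp v path_p uniq_p.
have eP: e \notin P.
  apply/negP => eP; have := degP u; rewrite (negPf u_p) => degPu.
  have: 0 < degree ends P u by apply: degree_gt0 eP _; rewrite def_e set21.
  lia.
exists (e |: P); split; first by rewrite subUset sub1set eA.
  move=> w; rewrite degreeU1 // def_e !inE; have := degP w; rewrite inE.
  have uv: u != v by move: u_p; rewrite inE negb_or => /andP[].
  have [->|_] := eqVneq w u; last by case: (w == v) => /=; lia.
  by move: u_p; rewrite inE negb_or => /andP[/negPf-> /negPf->]; lia.
have con_uv: connect (adjacent ends (e |: P)) u v.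
  by apply/connect1/(adjacentI _ def_e); rewrite setU11.
move=> w; rewrite inE => /predU1P[->//|/conP con_vw].
exact/(connect_trans con_uv)/(connect_adjacent_subset (subsetUr _ _)).
Qed.

(** Shorten the connection to a simple path; closing it with [e] supplies the missing degree at both
    ends. *)
Lemma circle_of_connect A e u v :
    e \notin A -> ends e = [set u; v] -> u != v ->
    connect (adjacent ends A) u v ->
  exists2 C : {set E}, C \subset e |: A & circle ends C.
Proof.
move=> eA def_e uv /connectP[p path_p def_v].
case/shortenP: path_p def_v => {}p path_p uniq_p _ def_v.
have [P [sPA degP conP]] := path_edges path_p uniq_p.
have eP: e \notin P by apply: contra eA; apply: (subsetP sPA).
have degC w: degree ends (e |: P) w = (w \in u :: p).*2.
  rewrite degreeU1 // -degP -def_v def_e !inE.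
  have [->|_] := eqVneq w u; last by case: (w == v) => /=; lia.
  by rewrite (negPf uv); lia.
have conC w: w \in u :: p -> connect (adjacent ends (e |: P)) u w.
  by move/conP; apply/connect_adjacent_subset/subsetUr.
exists (e |: P); first exact: setUS.
apply/and3P; split; first by apply/set0Pn; exists e; rewrite setU11.
  by apply/forallP => w; apply/implyP; rewrite degC; case: (w \in _).
apply/forallP => x; apply/forallP => y; apply/implyP; rewrite !degC.
rewrite !double_gt0 !lt0b => /andP[px py].
apply: connect_trans (conC _ py).
by rewrite (sym_connect_sym (@adjacent_sym _)) conC.
Qed.

End Multigraph.

(** The witness is the length of a shortest path to [r]: the next vertex on such a path is strictly
    closer. *)
Lemma connect_descent (T : finType) (e : rel T) (r : T) :
    (forall v, connect e v r) ->
  exists d : T -> nat, forall v, v != r -> exists2 w, e v w & d w < d v.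
Proof.
move=> con_r.
have len_ex v: exists k, [exists p : k.-tuple T, path e v p && (last v p == r)].
  have /connectP[p path_p ->] := con_r v; exists (size p).
  by apply/existsP; exists (in_tuple p); rewrite path_p /=.
exists (fun v => ex_minn (len_ex v)) => v v_r.
case: (ex_minnP (len_ex v)) => k /existsP[p /andP[path_p /eqP last_p]] _.
case: k p path_p last_p => [|k] p.
  by rewrite (tuple0 p) /= => _ vr; rewrite vr eqxx in v_r.
case/tupleP: p => w p /= /andP[vw path_p] last_p; exists w => //.
case: (ex_minnP (len_ex w)) => m _ min_m; rewrite ltnS min_m //.
by apply/existsP; exists p; rewrite path_p last_p /=.
Qed.

(** * Cayley's formula *)

Section ParentMaps.

Variable n : nat.
Implicit Types (p : {ffun 'I_n -> 'I_n.+1}) (i j : 'I_n) (v w : 'I_n.+1).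

(* The root is [ord0]; [p i] is the parent of the vertex [lift ord0 i]. *)
Definition parent_step p v : 'I_n.+1 :=
  if unlift ord0 v is Some i then p i else ord0.

Definition rooted p : bool := [forall v, fconnect (parent_step p) v ord0].

Definition depth p v : nat := findex (parent_step p) v ord0.

Definition parent_edges p : {set {set 'I_n.+1}} :=
  [set [set lift ord0 i; p i] | i : 'I_n].

Lemma parent_step_lift p i : parent_step p (lift ord0 i) = p i.
Proof. by rewrite /parent_step liftK. Qed.

Lemma depth_parent p i : rooted p -> depth p (p i) < depth p (lift ord0 i).
Proof.
move=> /forallP rp; rewrite /depth (fconnect_findex (rp (lift ord0 i)))
  ?neq_lift //.
by rewrite parent_step_lift.
Qed.

Lemma parent_neq p i : rooted p -> p i != lift ord0 i.
Proof.
by move=> rp; apply: contraTneq (depth_parent i rp) => ->; rewrite ltnn.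
Qed.

Lemma rooted_of_descent p (d : 'I_n.+1 -> nat) :
  (forall i, d (p i) < d (lift ord0 i)) -> rooted p.
Proof.
move=> d_lt; apply/forallP => v; have [m] := ubnP (d v).
elim: m v => // m IHm v; rewrite ltnS => d_v.
case: (unliftP ord0 v) => [i|] def_v; last by rewrite def_v connect0.
apply: (@connect_trans _ _ (p i)).
  by rewrite def_v -[X in fconnect _ _ X]parent_step_lift fconnect1.
by apply: IHm; apply: leq_trans d_v; rewrite def_v d_lt.
Qed.

Lemma parent_edges_connect p v :
  rooted p -> connect (adjacent id (parent_edges p)) v ord0.
Proof.
move=> rp; have [m] := ubnP (depth p v).
elim: m v => // m IHm v; rewrite ltnS => d_v.
case: (unliftP ord0 v) => [i|] def_v; last by rewrite def_v connect0.
apply: (@connect_trans _ _ (p i)).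
  apply/connect1/(@adjacentI _ _ _ _ [set lift ord0 i; p i]);
    last by rewrite def_v.
  by apply/imsetP; exists i.
by apply: IHm; apply: leq_trans d_v; rewrite def_v depth_parent.
Qed.

Lemma parent_edges_tree p : rooted p -> is_tree (parent_edges p).
Proof.
move=> rp; apply/and3P; split.
- apply/forallP => e; apply/implyP => /imsetP[i _ ->].
  by rewrite cards2 [lift _ _ == _]eq_sym parent_neq.
- apply/forallP => u; apply/forallP => v.
  apply: connect_trans (parent_edges_connect u rp) _.
  by rewrite (sym_connect_sym (@adjacent_sym _ _ _ _)) parent_edges_connect.
(* At a vertex of maximal depth in a circle, both edges lead to its parent. *)
apply/forallP => C; apply/implyP => /subsetP sCp; apply/negP.
case/and3P=> /set0Pn[e0 e0C] /forallP deg2 _.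
have [i0 _ def_e0] := imsetP (sCp _ e0C).
have deg_i0: 0 < degree id C (lift ord0 i0).
  by apply: degree_gt0 e0C _; rewrite def_e0 set21.
case: (@arg_maxnP _ _ (fun v => 0 < degree id C v) (depth p) deg_i0) =>
  v deg_v max_v.
have def_edge e : e \in C -> v \in e ->
    exists2 i, v = lift ord0 i & e = [set v; p i].
  move=> eC; have [i _ def_e] := imsetP (sCp _ eC); rewrite def_e !inE.
  case/orP=> /eqP def_v; first by exists i; rewrite // def_v.
  have/max_v: 0 < degree id C (lift ord0 i).
    by apply: degree_gt0 eC _; rewrite def_e set21.
  by rewrite /= leqNgt def_v depth_parent.
have: 1 < degree id C v by have /implyP/(_ deg_v)/eqP-> := deg2 v.
case/card_gt1P=> e [f []]; rewrite !inE => /andP[eC ve] /andP[fC vf].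
have [i def_v ->] := def_edge e eC ve; have [j def_v' ->] := def_edge f fC vf.
have ij : lift ord0 i = lift ord0 j by rewrite -def_v.
by rewrite (lift_inj ij) eqxx.
Qed.

(** Induction on depth in [p]. The edge from [i] to its parent also comes from [q]. If it did so
    with the roles of child and parent exchanged, the shallower end would, by induction, have [i] as
    its parent in [p] too, against the decrease of depth. *)
Lemma parent_edges_inj : {in rooted &, injective parent_edges}.
Proof.
move=> p q rp rq eq_pq; apply/ffunP => i.
have [m] := ubnP (depth p (lift ord0 i)).
elim: m i => // m IHm i; rewrite ltnS => d_i.
have: [set lift ord0 i; p i] \in parent_edges q.
  by rewrite -eq_pq; apply/imsetP; exists i.
case/imsetP=> j _ eq_ij.
have: lift ord0 i \in [set lift ord0 j; q j] by rewrite -eq_ij set21.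
have: p i \in [set lift ord0 j; q j] by rewrite -eq_ij set22.
rewrite !inE => /orP[]/eqP pi; last first.
  case/orP=> /eqP i_j; first by rewrite pi (lift_inj i_j).
  by have := parent_neq i rp; rewrite pi i_j eqxx.
have [/lift_inj i_j|_ /= /eqP i_qj] := eqVneq (lift ord0 i) (lift ord0 j).
  by have := parent_neq i rp; rewrite pi i_j eqxx.
have d_j : depth p (lift ord0 j) < depth p (lift ord0 i).
  by rewrite -pi depth_parent.
have := depth_parent j rp; rewrite IHm; last exact: leq_trans d_j d_i.
by rewrite -i_qj ltnNge ltnW.
Qed.

Lemma tree_parent_edges (T : {set {set 'I_n.+1}}) :
  is_tree T -> exists2 p, rooted p & parent_edges p = T.
Proof.
case/and3P=> /forallP T2 /forallP conT /forallP acT.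
have [d d_lt] := connect_descent (fun v => forallP (conT v) ord0).
pose towards_root i : pred _ := fun w => adjacent id T (lift ord0 i) w
  && (d w < d (lift ord0 i)).
(* Each vertex chooses a neighbour closer to the root. The default is never taken, since such a
   neighbour always exists. *)
pose p := [ffun i => odflt ord0 (pick (towards_root i))].
have p_towards i : towards_root i (p i).
  rewrite ffunE; case: pickP => //= none.
  have [|w adj lt_w] := d_lt (lift ord0 i); first by rewrite eq_sym neq_lift.
  by have := none w; rewrite /towards_root adj lt_w.
have rp : rooted p.
  by apply: (@rooted_of_descent p d) => i; have /andP[] := p_towards i.
exists p => //; apply/eqP; rewrite eqEsubset; apply/andP.
have sub_pT : parent_edges p \subset T.
  apply/subsetP => _ /imsetP[i _ ->].
  by have /andP[/existsP[e /andP[eT /eqP<-]] _] := p_towards i.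
(* The chosen edges already connect all vertices, so a further edge of [T] would close a circle
   inside [T]. *)
split=> //; apply/subsetP => e eT; apply/negPn/negP => e_p.
have /cards2P[a [b [ab def_e]]] := implyP (T2 e) eT.
have /and3P[_ /forallP/(_ a)/forallP/(_ b) con_ab _] := parent_edges_tree rp.
have [C sC circC] := circle_of_connect e_p def_e ab con_ab.
have /implyP noC := acT C; move: circC; apply/negP/noC.
by apply: subset_trans sC _; rewrite subUset sub1set eT.
Qed.

Lemma card_tree_rooted :
  #|[set T : {set {set 'I_n.+1}} | is_tree T]| = #|[set p | rooted p]|.
Proof.
rewrite -(card_in_imset (f := parent_edges)).
  apply: eq_card => T; rewrite inE; apply/idP/imsetP => [|[p]].
    by case/tree_parent_edges=> p rp <-; exists p; rewrite ?inE.
  by rewrite inE => rp ->; apply: parent_edges_tree.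
by move=> p q; rewrite !inE; apply: parent_edges_inj.
Qed.

Local Open Scope ring_scope.

(** The reduced Laplacian of the digraph of [p]: the root has neither row nor column, so a parent
    equal to the root contributes no entry. *)
Definition parent_mx p : 'M[rat]_n :=
  \matrix_(i, j) ((i == j)%:R - (lift ord0 j == p i)%:R).

(** For rooted [p] only the identity survives in the Leibniz expansion. Otherwise the indicator
    vector of the vertices that never reach the root lies in the kernel, because a vertex is lost
    exactly when its parent is. *)
Lemma det_parent_mx p : \det (parent_mx p) = (rooted p)%:R.
Proof.
have [rp|not_rp] := boolP (rooted p).
  rewrite /determinant (bigD1 (1%g : {perm 'I_n})) //= odd_perm1 expr0 mul1r.
  rewrite [X in _ + X]big1 ?addr0 => [|s s_neq1].
    apply: big1 => i _.
    by rewrite mxE perm1 eqxx eq_sym (negPf (parent_neq i rp)) subr0.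
  have [i s_i] : exists i, s i != i.
    apply/existsP; apply: contraNT s_neq1 => /existsPn fix_s.
    by apply/eqP/permP => i; rewrite perm1; apply/eqP;
      rewrite -[_ == _]negbK fix_s.
  (* A nonzero term would make the p-orbit of i follow the cycle of s through i,
     hence miss the root. *)
  apply/eqP; rewrite mulf_eq0 signr_eq0 /=; apply/prodf_eq0; apply/exists_inP.
  apply/contraT => /exists_inPn nz.
  have orb k : iter k (parent_step p) (lift ord0 i) = lift ord0 ((s ^+ k)%g i).
    elim: k => [|k IHk] /=; first by rewrite expg0 perm1.
    rewrite IHk parent_step_lift expgSr permM.
    have := nz ((s ^+ k)%g i) isT; rewrite !mxE.
    have [fix_k|_] := eqVneq ((s ^+ k)%g i) (s ((s ^+ k)%g i)).
      case/negP: s_i; apply/eqP; apply: (@perm_inj _ (s ^+ k)%g).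
      by rewrite -permM -expgS expgSr permM -fix_k.
    by case: (eqVneq (lift _ _)) => [->|_]; rewrite // subr0 eqxx.
  have /iter_findex := forallP rp (lift ord0 i).
  by rewrite orb => /eqP; rewrite eq_sym (negPf (neq_lift _ _)).
have /forallPn[v0 v0_lost] := not_rp.
pose lost v := ~~ fconnect (parent_step p) v ord0.
have lost_step v : lost (parent_step p v) = lost v.
  rewrite /lost; congr (~~ _); case: (unliftP ord0 v) => [i|] -> //; last first.
    by rewrite /parent_step unlift_none.
  by rewrite [RHS]fconnect_eqVf eq_sym (negPf (neq_lift _ _)).
have lost0 : lost ord0 = false by rewrite /lost connect0.
apply/eqP; rewrite -det_tr; apply/det0P.
exists (\row_j (lost (lift ord0 j))%:R).
  case: (unliftP ord0 v0) v0_lost => [i|] -> v0_lost;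
    last by rewrite connect0 in v0_lost.
  by apply/eqP => /rowP/(_ i); rewrite !mxE /lost v0_lost => /eqP;
    rewrite oner_eq0.
apply/rowP => i; rewrite !mxE.
under eq_bigr => j _ do rewrite !mxE mulrBr.
rewrite sumrB [X in X - _](_ : _ = (lost (lift ord0 i))%:R); last first.
  rewrite (bigD1 i) //= eqxx mulr1 big1 ?addr0 // => j /negPf ji.
  by rewrite eq_sym ji mulr0.
rewrite -lost_step parent_step_lift.
case: (unliftP ord0 (p i)) => [j|] def_pi; rewrite def_pi.
  rewrite (bigD1 j) //= eqxx mulr1 big1 ?addr0 ?subrr // => k /negPf kj.
  by rewrite (inj_eq (@lift_inj _ _)) kj mulr0.
rewrite lost0 big1 ?subrr // => j _.
by rewrite eq_sym (negPf (neq_lift _ _)) mulr0.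
Qed.

Lemma card_rooted_det :
  #|[set p | rooted p]|%:R
  = \det (\matrix_(i < n, j < n) (n.+1%:R * (i == j)%:R - 1 : rat)).
Proof.
rewrite -sum1_card natr_sum big_mkcond /=.
rewrite (eq_bigr (fun p => \det (parent_mx p))); last first.
  by move=> p _; rewrite det_parent_mx inE; case: rooted.
rewrite /determinant exchange_big; apply: eq_bigr => s _ /=.
rewrite -big_distrr; congr (_ * _) => /=.
under eq_bigr => p _ do under eq_bigr => i _ do rewrite mxE.
(* Row [i] depends on [p i] alone, so the sum over [p] of products is a product of row sums. Over
   the n + 1 possible parents, the diagonal term is counted n + 1 times and the subtracted one
   once. *)
rewrite -(bigA_distr_bigA
            (fun i v => (i == s i)%:R - (lift ord0 (s i) == v)%:R)).
apply: eq_bigr => i _; rewrite mxE sumrB sumr_const card_ord.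
congr (_ - _); first by rewrite mulr_natl.
rewrite (bigD1 (lift ord0 (s i))) //= eqxx big1 ?addr0 //.
by move=> v /negPf; rewrite eq_sym => ->.
Qed.

(** The matrix is a scalar matrix minus the rank-one product [u *m v]. Eliminating either diagonal
    block of one bordered matrix gives two factorizations, whose determinants are compared. *)
Lemma det_scalarB1 (F : fieldType) (a : F) : a != 0 ->
  \det (\matrix_(i < n, j < n) (a * (i == j)%:R - 1)) = (1 - n%:R / a) * a ^+ n.
Proof.
move=> a0; pose v : 'rV[F]_n := const_mx 1; pose u : 'cV[F]_n := const_mx 1.
have -> : \matrix_(i < n, j < n) (a * (i == j)%:R - 1) = a%:M - u *m v.
  apply/matrixP => i j; rewrite !mxE big_ord1 !mxE mulr1.
  by rewrite mulr_natr.
have vu : v *m u = (n%:R)%:M.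
  apply/matrixP => i j; rewrite !ord1 !mxE mulr1n.
  under eq_bigr => k _ do rewrite !mxE mulr1.
  by rewrite sumr_const card_ord.
have eq1 : block_mx 1%:M v u a%:M
    = block_mx 1%:M 0 u 1%:M *m block_mx 1%:M v 0 (a%:M - u *m v).
  rewrite mulmx_block !mul1mx !mulmx1 !mul0mx !addr0.
  by rewrite addrC subrK.
have eq2 : block_mx 1%:M v u a%:M
    = block_mx (1 - n%:R / a)%:M v 0 a%:M *m block_mx 1%:M 0 (a^-1 *: u) 1%:M.
  rewrite mulmx_block !mulmx1 !mul0mx !mulmx0 !add0r.
  rewrite -scalemxAr vu mul_scalar_mx scalerA mulfV // scale1r.
  rewrite scale_scalar_mx -raddfD /=; congr (block_mx _%:M _ _ _).
  by rewrite mulrC subrK.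
have := congr1 determinant eq1; rewrite eq2 !det_mulmx !det_lblock !det_ublock.
by rewrite !det1 !mul1r !mulr1 !det_scalar expr1 => <-.
Qed.

End ParentMaps.

Theorem cayley (n : nat) : 0 < n ->
  #|[set T : {set {set 'I_n.+1}} | is_tree T]| = n.+1 ^ n.-1.
Proof.
case: n => // n _; apply/eqP; rewrite -(eqr_nat rat) card_tree_rooted.
rewrite card_rooted_det det_scalarB1 ?pnatr_eq0 // natrX exprS /= mulrA.
apply/eqP; rewrite -[RHS]mul1r; congr (_ * _)%R.
by rewrite mulrBl mul1r mulfVK ?pnatr_eq0 // -natrB // subSnn.
Qed.

(** * Cyclic directions of even edge sets *)

Section Orientation.

Variable n : nat.
Implicit Types (e f : shi_edge n) (C D P : {set shi_edge n}) (a b v w : 'I_n).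

Lemma lower_neq_upper e : lower e != upper e.
Proof.
by apply: contraTneq (valP e); rewrite /lower /upper => ->; rewrite ltnn.
Qed.

Lemma shi_ends_orient D e v :
  (v \in shi_ends e) = (source D e == v) + (target D e == v) :> nat.
Proof.
rewrite !inE /source /target ![v == _]eq_sym.
have := lower_neq_upper e.
case: ifP => _; have [->|_] := eqVneq (lower e) v;
  by have [|] := eqVneq (upper e) v.
Qed.

Definition out_degree D P v : nat := \sum_(e in P) (source D e == v).
Definition in_degree D P v : nat := \sum_(e in P) (target D e == v).

Lemma degree_orient D P v :
  degree (@shi_ends n) P v = out_degree D P v + in_degree D P v.
Proof.
by rewrite degreeE -big_split; apply: eq_bigr => e _; apply: shi_ends_orient.
Qed.

(* The degree condition on a directed trail in P from a to b. *)
Definition trail D P a b : Prop :=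
  forall w, out_degree D P w + (b == w) = in_degree D P w + (a == w).

Lemma trail_extend D P a b f :
    trail D P a b -> f \notin P -> b \in shi_ends f ->
  exists D' c, trail D' (f |: P) a c.
Proof.
move=> tP fP bf.
(* Direct [f] out of [b]; the edges of [P] keep their directions. *)
pose D' := if b == lower f then f |: D else D :\ f.
have D'P e : e \in P -> (e \in D') = (e \in D).
  move=> eP; have ef: e != f by apply: contraNneq fP => <-.
  by rewrite /D'; case: ifP => _; rewrite !inE ?ef ?(negPf ef).
have srcf : source D' f = b.
  move: bf; rewrite /source /D' !inE; case: (eqVneq b (lower f)) => [->|_] /=.
    by rewrite setU11.
  by rewrite setD11 => /eqP.
exists D', (target D' f) => w; rewrite /out_degree /in_degree !big_setU1 //=
  srcf.
rewrite (eq_bigr (fun e => source D e == w : nat)) => [|e eP]; last first.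
  by rewrite /source D'P.
rewrite [X in _ = _ + X + _](eq_bigr (fun e => target D e == w : nat)) =>
  [|e eP].
  by rewrite [(b == w) + _]addnC; have := tP w; rewrite /out_degree => ->;
    rewrite addnC addnA.
by rewrite /target D'P.
Qed.

(* A maximal directed trail in an even graph is closed and uses every edge:
   a closed trail may be taken to start and end at any vertex, hence be extended
   by any unused edge. *)
Lemma even_cyclic_direction C :
    (forall v, ~~ odd (degree (@shi_ends n) C v)) ->
  exists D, cyclic_direction D C.
Proof.
move=> evenC.
suff [D eqC] : exists D, forall v, out_degree D C v = in_degree D C v.
  by exists D; apply/forallP => v; rewrite -!sum_nat_pred; apply/eqP/eqC.
have [->|/set0Pn[e0 e0C]] := eqVneq C set0.
  by exists set0 => v; rewrite /out_degree /in_degree !big_set0.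
have step k : k <= #|C| ->
    exists D P a b, [/\ P \subset C, #|P| = k & trail D P a b].
  elim: k => [_|k IHk ltkC].
    exists set0, set0, (lower e0), (lower e0); split;
      rewrite ?sub0set ?cards0 //.
    by move=> w; rewrite /out_degree /in_degree !big_set0.
  have [D [P [a [b [sPC cardP tP]]]]] := IHk (ltnW ltkC).
  suff [a' [b' [f [fC fP tP' bf]]]] : exists a' b' f,
      [/\ f \in C, f \notin P, trail D P a' b' & b' \in shi_ends f].
    have [D' [c tP'']] := trail_extend tP' fP bf.
    exists D', (f |: P), a', c; split=> //; first by rewrite subUset sub1set fC.
    by rewrite cardsU1 fP cardP.
  have [eq_ab|ab] := eqVneq a b.
    have /properP[_ [f fC fP]] : P \proper C.
      by rewrite properEcard sPC cardP.
    exists (lower f), (lower f), f; split; rewrite ?set21 // => w.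
    by have := tP w; rewrite eq_ab => /addIn->.
  have oddP : odd (degree (@shi_ends n) P b).
    have := tP b; rewrite (degree_orient D) eqxx (negPf ab).
    by rewrite addn0 addn1 => <-; rewrite addnS oddS addnn odd_double.
  have : 0 < degree (@shi_ends n) (C :\: P) b.
    rewrite lt0n; apply: contraTneq oddP => deg0.
    suff -> : degree (@shi_ends n) P b = degree (@shi_ends n) C b.
      exact: evenC.
    rewrite !degreeE [RHS](big_setID P) /= (setIidPr sPC).
    by rewrite -[X in _ + X]degreeE deg0 addn0.
  case/card_gt0P=> f; rewrite !inE => /andP[/andP[fP fC] bf].
  by exists a, b, f; split; rewrite // !inE.
have [D [P [a [b [sPC cardP tP]]]]] := step _ (leqnn _).
have eqPC : P = C by apply/eqP; rewrite eqEcard sPC cardP leqnn.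
exists D => v; have := tP v; rewrite eqPC.
have [->|ab] := eqVneq a b; first by move/addIn.
have := tP b; rewrite eqxx (negPf ab) addn0 addn1 eqPC => outb.
have := evenC b; rewrite (degree_orient D) -outb addnS oddS addnn odd_double.
by [].
Qed.

End Orientation.

(** * Broken circuits and colourings *)

Section Toggle.

Variable T : finType.
Implicit Types (e : T) (A S : {set T}).

Definition toggle e A : {set T} := if e \in A then A :\ e else e |: A.

Lemma in_toggle e A f : (f \in toggle e A) = (f == e) (+) (f \in A).
Proof.
rewrite /toggle; case: ifP => eA; rewrite !inE.
  by have [->|] := eqVneq f e; rewrite ?eA.
by have [->|] := eqVneq f e; rewrite ?eA.
Qed.

Lemma toggleK e : involutive (toggle e).
Proof. by move=> A; apply/setP => f; rewrite !in_toggle addKb. Qed.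

Lemma sub_toggle e A S : e \in S -> (toggle e A \subset S) = (A \subset S).
Proof.
move=> eS; rewrite /toggle; case: ifP => eA; last by rewrite subUset sub1set eS.
by rewrite -[in RHS](setD1K eA) subUset sub1set eS.
Qed.

Lemma toggle_sign e A : ((-1) ^+ #|toggle e A| = - (-1) ^+ #|A| :> int)%R.
Proof.
rewrite /toggle; case: ifP => eA; last by rewrite cardsU1 eA exprS mulN1r.
by rewrite [in RHS](cardsD1 e) eA exprS mulN1r opprK.
Qed.

Lemma sum_involution_eq0 (F : {set T} -> {set T}) (Q : pred {set T})
    (s : {set T} -> int) :
    involutive F -> (forall A, Q (F A) = Q A) ->
    (forall A, Q A -> s (F A) = - s A)%R ->
  (\sum_(A | Q A) s A = 0)%R.
Proof.
move=> FK QF sF.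
suff: (\sum_(A | Q A) s A = - \sum_(A | Q A) s A)%R by lia.
rewrite [LHS](reindex_inj (inv_inj FK)) -sumrN.
by apply: eq_big => [A|A]; rewrite QF // => /sF.
Qed.

Lemma sum_sign_subset S :
  (\sum_(A : {set T} | A \subset S) (-1) ^+ #|A| = (S == set0)%:R :> int)%R.
Proof.
have [->|/set0Pn[e eS]] := eqVneq S set0.
  by rewrite (big_pred1 set0) ?cards0 // => A; rewrite subset0.
apply: (sum_involution_eq0 (toggleK e)) => [A|A _]; first exact: sub_toggle.
exact: toggle_sign.
Qed.

End Toggle.

(** * Cancellation of the edge sets that contain a broken circuit *)

Section BrokenCircuits.

Variables (n : nat) (le : rel (shi_edge n)).
Hypotheses (le_refl : reflexive le) (le_anti : antisymmetric le).
Hypotheses (le_trans : transitive le) (le_total : total le).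
Implicit Types (e f : shi_edge n) (A C S : {set shi_edge n}).

(** The edge [e] completes a broken circuit contained in [A]. Whether [e] lies in [A] is left open,
    so that the condition survives toggling [e]. *)
Definition breaks A e : bool :=
  [exists C : {set shi_edge n}, [&& balanced_circle C, e \in C,
     [forall f in C, le e f] & C :\ e \subset A]].

Lemma breaksP A e : reflect
  (exists C : {set shi_edge n}, [/\ balanced_circle C, e \in C,
     forall f, f \in C -> le e f & C :\ e \subset A]) (breaks A e).
Proof.
apply: (iffP existsP) => -[C].
  by case/and4P=> balC eC /forall_inP minC sCA; exists C.
by case=> balC eC minC sCA; exists C; apply/and4P; split=> //; apply/forall_inP.
Qed.

Lemma nbc_setE A : nbc_set le A = balanced A && ~~ [exists e, breaks A e].
Proof.
rewrite /nbc_set; congr (_ && _); apply/forallP/existsPn => [nb e|nb B].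
  apply/negP => /existsP[C /and4P[balC eC minC sCA]].
  have /implyP/(_ _)/negP[] // := nb (C :\ e).
  by apply/existsP; exists C; apply/existsP; exists e;
    rewrite eC balC minC eqxx.
apply/implyP => /existsP[C /existsP[e /andP[eC /and3P[balC minC /eqP->]]]].
apply: contra (nb e) => sCA.
by apply/existsP; exists C; rewrite balC eC minC.
Qed.

Lemma exists_le_min A : A != set0 ->
  exists2 e, e \in A & forall f, f \in A -> le e f.
Proof.
case/set0Pn=> e0 e0A.
have [] := @extremumP _ _ le e0 (fun e => e \in A) id le_refl le_trans
  le_total e0A.
by move=> e eA minA; exists e.
Qed.

(** A circle in a balanced set is balanced, so deleting its smallest edge would leave a broken
    circuit. *)
Lemma nbc_acyclic A C : nbc_set le A -> C \subset A ->
  ~~ circle (@shi_ends n) C.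
Proof.
rewrite nbc_setE => /andP[/forallP balA /existsPn nb] sCA.
apply/negP => circC; have [e eC minC] := exists_le_min (proj1 (andP circC)).
have /breaksP[] := nb e; exists C; split=> //.
  by have /implyP-> := balA C; rewrite // sCA.
exact: subset_trans (subD1set _ _) sCA.
Qed.

Definition largest_break A e : bool :=
  breaks A e && [forall f, breaks A f ==> le f e].

Lemma largest_break_uniq A e f : largest_break A e -> largest_break A f ->
  e = f.
Proof.
case/andP=> be /forallP maxe /andP[bf /forallP maxf].
by apply: le_anti; rewrite (implyP (maxe f)) ?(implyP (maxf e)).
Qed.

Lemma largest_break_exists A e : breaks A e -> exists f, largest_break A f.
Proof.
move=> be; have ge_trans : transitive (fun f g => le g f).
  by move=> y x z xy yz; apply: le_trans xy.
have ge_total : total (fun f g => le g f) by move=> x y; apply: le_total.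
have [] := @extremumP _ _ (fun f g => le g f) e (breaks A) id le_refl ge_trans
  ge_total be.
move=> f bf maxf; exists f; rewrite /largest_break bf.
by apply/forallP => g; apply/implyP => /maxf.
Qed.

(* An edge smaller than f lies on no circle whose smallest edge is f. *)
Lemma breaks_toggle A e f : le e f -> breaks (toggle e A) f = breaks A f.
Proof.
move=> le_ef; apply: eq_existsb => C.
case balC: (balanced_circle C); case fC: (f \in C) => //=.
case: forall_inP => //= minC.
have e_C : e \notin C :\ f.
  rewrite !inE; apply/andP => -[ef /minC le_fe].
  by case/eqP: ef; apply: le_anti; rewrite le_ef.
have in_e g : g \in C :\ f -> (g \in toggle e A) = (g \in A).
  by move=> gC; rewrite in_toggle; case: eqVneq e_C => // <-; rewrite gC.
by apply/subsetP/subsetP => sC g gC; have := sC g gC; rewrite in_e.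
Qed.

(** Toggling [e] does not alter which edges from [e] upwards break the set, so the same edge is
    selected again and the toggle is undone by repeating it. *)
Lemma largest_break_toggle A e :
  largest_break A e -> largest_break (toggle e A) e.
Proof.
case/andP=> be /forallP maxe; rewrite /largest_break breaks_toggle // be /=.
apply/forallP => f; apply/implyP => bf.
have [//|le_ef] := orP (le_total f e).
by apply: (implyP (maxe f)); rewrite breaks_toggle in bf.
Qed.

Definition toggle_break A : {set shi_edge n} :=
  if [pick e | largest_break A e] is Some e then toggle e A else A.

Lemma toggle_breakE A e : largest_break A e -> toggle_break A = toggle e A.
Proof.
move=> be; rewrite /toggle_break; case: pickP => [f bf|/(_ e)];
  last by rewrite be.
by rewrite (largest_break_uniq be bf).
Qed.

Lemma toggle_breakK : involutive toggle_break.
Proof.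
move=> A; rewrite {2}/toggle_break; case: pickP => [e be|none].
  by rewrite (toggle_breakE (largest_break_toggle be)) toggleK.
by rewrite /toggle_break; case: pickP => // e; rewrite none.
Qed.

(** The closure hypothesis keeps the toggled edge inside [S], so the sign-reversing involution acts
    on the subsets of [S]. *)
Lemma sum_sign_breaks S : (forall e, breaks S e -> e \in S) ->
  (\sum_(A : {set shi_edge n} | (A \subset S) && [exists e, breaks A e])
     (-1) ^+ #|A| = 0 :> int)%R.
Proof.
move=> closedS.
have breaksS A e : A \subset S -> breaks A e -> e \in S.
  move=> sAS /breaksP[C [balC eC minC sCA]]; apply: closedS; apply/breaksP.
  by exists C; split=> //; apply: subset_trans sAS.
apply: (sum_involution_eq0 toggle_breakK) => A; last first.
  case/andP=> _ /existsP[e /largest_break_exists[f bf]].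
  by rewrite (toggle_breakE bf) toggle_sign.
rewrite /toggle_break; case: pickP => // e be.
have /andP[beA _] := be; have /andP[beA' _] := largest_break_toggle be.
have -> : [exists e, breaks A e] by apply/existsP; exists e.
have -> : [exists f, breaks (toggle e A) f] by apply/existsP; exists e.
rewrite !andbT; apply/idP/idP => sS.
  by rewrite -(sub_toggle _ (breaksS _ _ sS beA')).
by rewrite (sub_toggle _ (breaksS _ _ sS beA)).
Qed.

End BrokenCircuits.

(** * Colourings by a finite ring and Whitney's broken circuit theorem *)

Section Colourings.

Local Open Scope ring_scope.

Variables (n : nat) (R : finComNzRingType).
Implicit Types (x : {ffun 'I_n -> R}) (e f : shi_edge n).
Implicit Types (A C D : {set shi_edge n}).

Definition satisfied x : {set shi_edge n} :=
  [set e | x (upper e) - x (lower e) == (gain e)%:~R].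

Definition proper_colouring x : bool := satisfied x == set0.

Lemma sum_cyclic_direction D C x : cyclic_direction D C ->
  \sum_(e in C) (x (target D e) - x (source D e)) = 0.
Proof.
move=> /forallP cycC.
have sum_ends (s : shi_edge n -> 'I_n) :
    \sum_(e in C) x (s e) = \sum_v x v *+ #|[set e in C | s e == v]|.
  rewrite (partition_big s predT) //=; apply: eq_bigr => v _.
  rewrite -sumr_const; apply: eq_big => [e|e /andP[_ /eqP->]] //.
  by rewrite inE.
rewrite sumrB !sum_ends -sumrB big1 // => v _.
by rewrite (eqP (cycC v)) subrr.
Qed.

Definition defect x e : R := x (upper e) - x (lower e) - (gain e)%:~R.

Lemma satisfiedE x e : (e \in satisfied x) = (defect x e == 0).
Proof. by rewrite inE /defect subr_eq0. Qed.

(** The differences of vertex colours cancel around [C], leaving only the gains. *)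
Lemma sum_defect D C x : cyclic_direction D C ->
  \sum_(e in C) (if e \in D then defect x e else - defect x e)
  = - (gain_along D C)%:~R.
Proof.
move=> cycC; rewrite -[RHS]add0r -[in RHS](sum_cyclic_direction x cycC).
rewrite /gain_along rmorph_sum -sumrB; apply: eq_bigr => e _.
rewrite /defect /source /target; case: ifP => _ //=.
by rewrite rmorphN opprK !opprB addrC.
Qed.

(** The signed defects on [C] add up to zero, and all but that of [e] vanish. *)
Lemma balanced_circle_closed x C e :
  balanced_circle C -> e \in C -> C :\ e \subset satisfied x ->
    e \in satisfied x.
Proof.
move=> /andP[_ /existsP[D /andP[cycC /eqP gain0]]] eC /subsetP sat.
have := sum_defect x cycC; rewrite gain0 oppr0 (bigD1 e) //= big1 =>
  [|f /andP[fC fe]].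
  rewrite addr0 satisfiedE; case: ifP => _ /eqP //.
  by rewrite oppr_eq0.
have /eqP-> : defect x f == 0 by rewrite -satisfiedE sat // !inE fe.
by rewrite oppr0 if_same.
Qed.

Lemma normr_gain_along D C : `|gain_along D C| <= #|C|%:R.
Proof.
apply: le_trans (ler_norm_sum _ _ _) _; rewrite -sumr_const.
by apply: ler_sum => e _; rewrite /gain; case: ifP; case: (val e).2.
Qed.

(** The gain of a satisfied circle vanishes in [R]. It is an integer bounded by the number of edges,
    so the hypothesis on [R] makes it zero in the integers. *)
Lemma satisfied_balanced x A :
    (forall z : int, `|z| <= #|{: shi_edge n}|%:R -> z%:~R = 0 :> R -> z = 0) ->
  A \subset satisfied x -> balanced A.
Proof.
move=> charR /subsetP sat; apply/forallP => C;
  apply/implyP => /andP[/subsetP sCA circC].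
have [|D cycC] := @even_cyclic_direction _ C.
  move=> v; have /and3P[_ /forallP/(_ v)/implyP deg2 _] := circC.
  by case: posnP (deg2) => [->|_ /(_ isT)/eqP->].
rewrite /balanced_circle circC; apply/existsP; exists D; rewrite cycC /=.
apply/eqP/charR; first by apply: le_trans (normr_gain_along _ _) _;
  rewrite ler_nat max_card.
apply: oppr_inj; rewrite -(sum_defect x cycC) oppr0 big1 // => e /sCA/sat.
by rewrite satisfiedE => /eqP->; rewrite oppr0 if_same.
Qed.

(** Deleting [e] from the forest [A] separates its ends. Shifting the component of [upper e] by [t]
    keeps the other edges satisfied and changes the difference along [e] by [t]; hence each edge
    divides the count by [#|R|]. *)
Lemma card_satisfying A :
    (forall C, C \subset A -> ~~ circle (@shi_ends n) C) ->
  (#|[set x | A \subset satisfied x]| * #|R| ^ #|A| = #|R| ^ n)%N.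
Proof.
have [m] := ubnP #|A|; elim: m A => // m IHm A; rewrite ltnS => leAm acA.
have [->|/set0Pn[e eA]] := eqVneq A set0.
  rewrite cards0 muln1 -[in RHS](card_ord n) -card_ffun -cardsT.
  by apply: eq_card => x; rewrite !inE sub0set.
pose A' := A :\ e; have sA'A : A' \subset A := subD1set _ _.
have e_A' : e \notin A' by rewrite setD11.
pose K v := connect (adjacent (@shi_ends n) A') (upper e) v.
have K_lower : ~~ K (lower e).
  apply/negP => con_e.
  have [||C sC] := circle_of_connect e_A' _ _ con_e.
  - by rewrite setUC.
  - by rewrite eq_sym lower_neq_upper.
  - by apply/negP/acA; rewrite /A' setD1K in sC.
have K_A' f : f \in A' -> K (upper f) = K (lower f).
  move=> fA'; apply: same_connect_r; first exact/sym_connect_sym/adjacent_sym.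
  by apply/connect1/(adjacentI fA'); rewrite /shi_ends setUC.
pose shift (xt : {ffun 'I_n -> R} * R) : {ffun 'I_n -> R} :=
  [ffun v => xt.1 v + xt.2 *+ K v].
have shift_A' x t f :
    f \in A' -> (f \in satisfied (shift (x, t))) = (f \in satisfied x).
  by move=> fA'; rewrite !inE !ffunE /= K_A' // opprD addrACA subrr addr0.
have shift_e x t : shift (x, t) (upper e) - shift (x, t) (lower e)
                   = x (upper e) - x (lower e) + t.
  by rewrite !ffunE /= {1}/K connect0 (negPf K_lower) addr0 mulr1n addrAC.
have shiftK x t : shift (shift (x, t), - t) = x.
  by apply/ffunP => v; rewrite !ffunE /= -addrA -mulrnDl subrr mul0rn addr0.
have cardA' : #|[set x | A' \subset satisfied x]|
              = (#|[set x | A \subset satisfied x]| * #|R|)%N.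
  rewrite -cardsT -cardsX -(card_in_imset (f := shift)); last first.
    move=> [x t] [y s]; rewrite !inE /= !andbT =>
      /subsetP/(_ e eA) xe /subsetP/(_ e eA) ye.
    move=> eq_s; have := shift_e x t; rewrite eq_s shift_e; move: xe ye;
      rewrite !inE.
    move=> /eqP-> /eqP-> /addrI eq_t; rewrite -eq_t.
    by rewrite -(shiftK x t) eq_s -eq_t shiftK.
  apply: eq_card => z; rewrite inE; apply/idP/imsetP => [sat_z|[[x t]]].
    (* The defect of [z] at [e], which shifting by [- t] removes. *)
    pose t := z (upper e) - z (lower e) - (gain e)%:~R.
    exists (shift (z, - t), t); last by rewrite -[t in (_, t)]opprK shiftK.
    rewrite !inE andbT; apply/subsetP => f fA.
    have [->|fe] := eqVneq f e.
      by rewrite inE shift_e /t opprB addrC subrK.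
    have fA' : f \in A' by rewrite !inE fe.
    by rewrite shift_A' // (subsetP sat_z).
  rewrite !inE andbT => sat_x ->; apply/subsetP => f fA'; rewrite shift_A' //.
  by apply: (subsetP sat_x); apply: (subsetP sA'A).
rewrite -(IHm A') => [||C sC]; last 1 first.
- by apply: acA; apply: subset_trans sC sA'A.
- by rewrite cardA' -mulnA -expnS [in LHS](cardsD1 e) eA.
by apply: leq_trans leAm; rewrite [in X in (_ < X)%N](cardsD1 e) eA.
Qed.

Theorem whitney_broken_circuits (le : rel (shi_edge n)) :
    reflexive le -> antisymmetric le -> transitive le -> total le ->
    (forall z : int, `|z| <= #|{: shi_edge n}|%:R -> z%:~R = 0 :> R -> z = 0) ->
  \sum_(A | nbc_set le A) (-1) ^+ #|A| * #|[set x | A \subset satisfied x]|%:R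
  = #|[set x | proper_colouring x]|%:R :> int.
Proof.
move=> le_refl le_anti le_trans le_total charR.
rewrite -[in RHS]sum1_card natr_sum.
rewrite [RHS](_ : _ = \sum_x (proper_colouring x)%:R); last first.
  by rewrite big_mkcond; apply: eq_bigr => x _; rewrite inE;
    case: proper_colouring.
under eq_bigr => A _ do rewrite -[X in _ * X%:R]sum1_card natr_sum mulr_sumr.
rewrite (exchange_big_dep predT) //=; apply: eq_bigr => x _.
(* For fixed [x], properness is the signed sum over all subsets of [satisfied x]. The subsets with a
   broken circuit cancel; the others are balanced, hence NBC sets. *)
rewrite -sum_sign_subset [RHS](bigID (fun A => [exists e, breaks le A e])) /=.
rewrite sum_sign_breaks // => [|e /breaksP[C [balC eC _]]]; last first.
  exact: balanced_circle_closed.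
rewrite add0r; apply: eq_big => [A|A _]; last by rewrite mulr1.
rewrite nbc_setE inE andbC; have [sat|] //= := boolP (A \subset _).
by rewrite (satisfied_balanced charR sat).
Qed.

End Colourings.

(** * Proper colourings of the Shi gain graph *)

Section LinearColourings.

(* The colourings modulo [q.+1] that give the smallest label colour 0: no edge
   constraint then wraps around from colour [q] to colour 0. *)
Definition linear_colouring k q (y : {ffun 'I_k.+1 -> 'I_q.+1}) : bool :=
  [&& injectiveb y, y ord0 == ord0 &
      [forall i : 'I_k.+1, forall j : 'I_k.+1,
        (i < j) ==> (nat_of_ord (y j) != (y i).+1)]].

Lemma linear_colouringP k q (y : {ffun 'I_k.+1 -> 'I_q.+1}) :
  reflect [/\ injective y, y ord0 = ord0 &
              forall i j : 'I_k.+1, i < j -> nat_of_ord (y j) <> (y i).+1]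
          (linear_colouring y).
Proof.
apply: (iffP and3P) => -[/injectiveP yI y0 yS]; split=> //; first exact/eqP.
- by move=> i j ij; apply/eqP; move/forallP/(_ i)/forallP/(_ j)/implyP: yS;
    apply.
- exact/eqP.
by apply/forallP => i; apply/forallP => j; apply/implyP => /yS/eqP.
Qed.

(** The new label receives colour c + 1, and the old colours above [c] move up by one to make room.
    Colour 0 is never displaced. *)
Definition insert_last k q (y : {ffun 'I_k.+1 -> 'I_q.+1}) (c : 'I_q.+1) :
    {ffun 'I_k.+2 -> 'I_q.+2} :=
  [ffun j => if unlift ord_max j is Some i then lift (lift ord0 c) (y i)
             else lift ord0 c].

Lemma insert_last_max k q (y : {ffun 'I_k.+1 -> 'I_q.+1}) c :
  insert_last y c ord_max = lift ord0 c.
Proof. by rewrite ffunE unlift_none. Qed.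

Lemma insert_last_lift k q (y : {ffun 'I_k.+1 -> 'I_q.+1}) c i :
  insert_last y c (lift ord_max i) = lift (lift ord0 c) (y i).
Proof. by rewrite ffunE liftK. Qed.

(* Colour [c] of [y] is the one just below that of the new label; since the
   new label is the largest, this colour must be free, and then the other
   constraints are unaffected. *)
Lemma insert_last_linear k q (y : {ffun 'I_k.+1 -> 'I_q.+1}) c :
  linear_colouring (insert_last y c) = linear_colouring y && (c \notin codom y).
Proof.
have ord0E : ord0 = lift ord_max ord0 :> 'I_k.+2.
  by apply: val_inj; rewrite /= /bump.
have bump_i (i : 'I_k.+1) : bump k.+1 i = i.
  by have := ltn_ord i; rewrite /bump; lia.
apply/linear_colouringP/andP => [[xI x0 xS]|[/linear_colouringP[yI y0 yS] cy]].
  have cy : c \notin codom y.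
    apply/codomP => -[i cyi].
    have := xS (lift ord_max i) ord_max.
    rewrite insert_last_max insert_last_lift /= bump_i ltn_ord cyi /bump.
    by move=> /(_ isT); lia.
  split=> //; apply/linear_colouringP; split.
  - move=> i j eq_y; apply: (@lift_inj _ ord_max); apply: xI.
    by rewrite !insert_last_lift eq_y.
  - move: x0; rewrite ord0E insert_last_lift => /(congr1 val) /=.
    by rewrite /bump => y0; apply: val_inj => /=; lia.
  move=> i j ij; have := xS (lift ord_max i) (lift ord_max j).
  rewrite !insert_last_lift /= !bump_i => /(_ ij).
  have : nat_of_ord c <> y i.
    by move=> /val_inj cyi; case/negP: cy; rewrite cyi codom_f.
  by rewrite /bump; lia.
have cyi i : nat_of_ord c <> y i.
  by move=> /val_inj cyi; case/negP: cy; rewrite cyi codom_f.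
split.
- move=> i j; case: (unliftP ord_max i) => [i'|] ->;
    case: (unliftP ord_max j) => [j'|] -> //.
  + by rewrite !insert_last_lift => /lift_inj/yI->.
  + by rewrite insert_last_lift insert_last_max => /eqP;
      rewrite eq_sym (negPf (neq_lift _ _)).
  by rewrite insert_last_lift insert_last_max => /eqP;
    rewrite (negPf (neq_lift _ _)).
- by rewrite ord0E insert_last_lift y0; apply: val_inj.
move=> i j; case: (unliftP ord_max i) => [i'|] ->;
  case: (unliftP ord_max j) => [j'|] -> /=.
- rewrite !bump_i => ij; rewrite !insert_last_lift /=.
  by have := yS _ _ ij; have := cyi i'; rewrite /bump; lia.
- by move=> _; rewrite insert_last_lift insert_last_max /=; have := cyi i';
    rewrite /bump; lia.
- by rewrite bump_i => kj; have := ltn_ord j'; rewrite ltnNge ltnW.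
by rewrite ltnn.
Qed.

Lemma insert_last_surj k q (x : {ffun 'I_k.+2 -> 'I_q.+2}) :
  linear_colouring x -> exists y c, x = insert_last y c.
Proof.
case/linear_colouringP=> xI x0 _.
case: (unliftP ord0 (x ord_max)) => [c|] xm; last first.
  by have /(congr1 val) := xI _ _ (etrans xm (esym x0)).
exists [ffun i => odflt ord0 (unlift (lift ord0 c) (x (lift ord_max i)))], c.
apply/ffunP => j; case: (unliftP ord_max j) => [i|] ->;
  last by rewrite insert_last_max.
rewrite insert_last_lift ffunE.
case: (unliftP (lift ord0 c) (x (lift ord_max i))) => [d|] //=.
by rewrite -xm => /xI/eqP; rewrite eq_sym (negPf (neq_lift _ _)).
Qed.

(** A colouring [y] occupies k + 1 of the q + 1 colours, leaving q - k places for the next label. An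
    insertion raises both parameters by one, so their difference, the base of the power, stays the
    same. *)
Lemma card_linear_colouring k q :
  #|[set y : {ffun 'I_k.+1 -> 'I_q.+1} | linear_colouring y]| = (q - k) ^ k.
Proof.
elim: k q => [|k IHk] q.
  rewrite expn0 -[RHS](cards1 ([ffun=> ord0] : {ffun 'I_1 -> 'I_q.+1})).
  apply: eq_card => y; rewrite !inE; apply/linear_colouringP/eqP =>
    [[_ y0 _]|->].
    by apply/ffunP => i; rewrite ord1 ffunE y0.
  by split=> [i j _||i j]; rewrite ?ffunE ?ord1.
case: q => [|q].
  rewrite sub0n exp0n //; apply/eqP; rewrite cards_eq0; apply/eqP/setP => x.
  rewrite !inE; apply/negP => /linear_colouringP[xI _ _].
  have /(congr1 val) // : ord0 = ord_max :> 'I_k.+2.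
  by apply: xI; rewrite !ord1.
pose ins (yc : {ffun 'I_k.+1 -> 'I_q.+1} * 'I_q.+1) := insert_last yc.1 yc.2.
have insI : injective ins.
  move=> [y c] [z d]; rewrite /ins /= => eq_x.
  have /lift_inj cd : lift ord0 c = lift ord0 d.
    by rewrite -(insert_last_max y) eq_x insert_last_max.
  rewrite -cd in eq_x *; congr pair; apply/ffunP => i.
  by apply: (@lift_inj _ (lift ord0 c)); rewrite -!insert_last_lift eq_x.
pose Y := [set yc : {ffun 'I_k.+1 -> 'I_q.+1} * 'I_q.+1
              | linear_colouring yc.1 && (yc.2 \notin codom yc.1)].
rewrite (_ : [set x | _] = ins @: Y).
  rewrite (card_imset _ insI) -sum1_card.
  under eq_bigl => yc do rewrite inE.
  rewrite -(pair_big_dep (@linear_colouring k q) (fun y c => c \notin codom y)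
              (fun _ _ => 1)).
  rewrite (eq_bigr (fun=> q - k)) => [|y /linear_colouringP[yI _ _]].
    by rewrite sum_nat_const -cardsE IHk subSS expnS mulnC.
  rewrite sum1_card -[LHS](addKn #|codom y|) cardC card_codom //.
  by rewrite !card_ord subSS.
apply/setP => x; rewrite !inE; apply/idP/imsetP => [lin_x|[[y c] + ->]].
  have [y [c eq_x]] := insert_last_surj lin_x; exists (y, c) => //.
  by rewrite inE -insert_last_linear -eq_x.
by rewrite inE /ins insert_last_linear.
Qed.

End LinearColourings.

(** * Proper colourings modulo q + 2 *)

Section ShiColourings.

Local Open Scope ring_scope.

Variables (k q : nat).
Notation Zq := 'I_q.+2.
Implicit Types (x y : {ffun 'I_k.+1 -> Zq}).

Lemma proper_colouringP x :
  reflect (forall i j : 'I_k.+1, (i < j)%N -> x j != x i /\ x j != x i + 1)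
          (proper_colouring x).
Proof.
rewrite /proper_colouring -subset0; apply: (iffP subsetP) =>
  [prop_x i j ij|prop_x e].
  split; apply/negP => /eqP eq_x.
    have := prop_x (exist _ (i, j, false) ij).
    by rewrite !inE /lower /upper /gain /= eq_x subrr eqxx => /(_ isT).
  have := prop_x (exist _ (i, j, true) ij).
  by rewrite !inE /lower /upper /gain /= eq_x addrAC subrr add0r eqxx =>
    /(_ isT).
case: e => -[[i j] b] ij; rewrite !inE /lower /upper /gain /=.
have [/negPf xji /negPf xji1] := prop_x i j ij.
by case: b {ij}; rewrite /= ?subr_eq0 ?xji // subr_eq addrC xji1.
Qed.

Lemma proper_linear y : y ord0 = 0 ->
  proper_colouring y = linear_colouring (q := q.+1) y.
Proof.
move=> y0; have val_add1 (a : Zq) : nat_of_ord (a + 1) = (a.+1 %% q.+2)%N.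
  by rewrite /= modnDmr addn1.
apply/proper_colouringP/linear_colouringP => [prop_y|[yI _ yS] i j ij].
  split=> [i j eq_y||i j ij eq_y]; last 1 first.
  - have [_ /eqP[]] := prop_y i j ij; apply: ord_inj.
    by rewrite val_add1 -eq_y modn_small.
  - apply/val_inj; case: (ltngtP i j) => // ij.
      by have [] := prop_y _ _ ij; rewrite eq_y eqxx.
    by have [] := prop_y _ _ ij; rewrite eq_y eqxx.
  by rewrite y0; apply: val_inj.
split; first by apply: contraTneq ij => /yI->; rewrite ltnn.
apply/eqP => /(congr1 (@nat_of_ord _)); rewrite val_add1.
have := ltn_ord (y i); rewrite leq_eqVlt => /predU1P[->|lt_yi].
  (* Wrap-around: [y i] is the last colour and [y j] is 0. By injectivity [j] is then the smallest
     label, which cannot exceed [i]. *)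
  rewrite modnn => yj0.
  have /yI j0 : y j = y ord0 by rewrite y0; apply: val_inj.
  by rewrite j0 in ij.
by rewrite modn_small // => /(yS _ _ ij).
Qed.

(** Translating all colours preserves properness, and each proper colouring is a unique translate of
    one with colour 0 at the smallest label. *)
Lemma card_proper :
  #|[set x : {ffun 'I_k.+1 -> Zq} | proper_colouring x]|
  = (q.+2 * (q.+1 - k) ^ k)%N.
Proof.
pose shift (cy : Zq * {ffun 'I_k.+1 -> Zq}) := [ffun i => cy.1 + cy.2 i].
have proper_shift c y : proper_colouring (shift (c, y)) = proper_colouring y.
  rewrite /proper_colouring; congr (_ == _); apply/setP => e.
  by rewrite !inE !ffunE /= opprD addrACA subrr add0r.
pose Y := setX [set: Zq] [set y | linear_colouring (k := k) (q := q.+1) y].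
have -> : (q.+2 * (q.+1 - k) ^ k = #|Y|)%N.
  by rewrite cardsX cardsT card_ord card_linear_colouring.
rewrite -(card_in_imset (f := shift)).
  apply: eq_card => x; rewrite inE; apply/idP/imsetP => [prop_x|[[c y] + ->]].
    pose y := [ffun i => x i - x ord0].
    have x_y : x = shift (x ord0, y).
      by apply/ffunP => i; rewrite !ffunE /= addrC subrK.
    exists (x ord0, y); rewrite // !inE /= -proper_linear;
      last by rewrite ffunE subrr.
    by rewrite -(proper_shift (x ord0)) -x_y.
  rewrite !inE /= => lin_y; rewrite proper_shift proper_linear //.
  by have /linear_colouringP[_ -> _] := lin_y; apply: val_inj.
move=> [c y] [d z]; rewrite !inE /=.
move=> /linear_colouringP[_ y0 _] /linear_colouringP[_ z0 _] eq_x.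
have eq_cd : c = d.
  by have /ffunP/(_ ord0) := eq_x; rewrite !ffunE /= y0 z0 => /addIr.
rewrite -eq_cd in eq_x *; congr pair; apply/ffunP => i.
by have /ffunP/(_ i) := eq_x; rewrite !ffunE /= => /addrI.
Qed.

Lemma Zp_intr_eq0 (z : int) : `|z| <= q.+1%:R -> z%:~R = 0 :> 'I_q.+2 -> z = 0.
Proof.
have nat0 (m : nat) : (m <= q.+1)%N -> m%:R = 0 :> 'I_q.+2 -> m = 0%N.
  by move=> le_m /(congr1 val); rewrite /= (@val_Zp_nat q.+2) // modn_small.
rewrite natz; case: z => m le_m.
  by rewrite -pmulrn => /nat0 ->; [|lia].
by rewrite NegzE mulrNz => /eqP; rewrite oppr_eq0 -pmulrn => /eqP/nat0; lia.
Qed.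

End ShiColourings.

(** * The generating polynomial and number of NBC sets *)

Section NBC.

Local Open Scope ring_scope.

Variables (k : nat) (le : rel (shi_edge k.+1)).
Hypotheses (le_refl : reflexive le) (le_anti : antisymmetric le).
Hypotheses (le_trans : transitive le) (le_total : total le).

Lemma nbc_card_satisfying q (A : {set shi_edge k.+1}) : nbc_set le A ->
  (#|A| <= k.+1)%N /\
  #|[set x : {ffun 'I_k.+1 -> 'I_q.+2} | A \subset satisfied x]|
    = (q.+2 ^ (k.+1 - #|A|))%N.
Proof.
move=> nbcA; set s := (X in _ /\ X = _).
have s_eq : (s * q.+2 ^ #|A| = q.+2 ^ k.+1)%N.
  have := @card_satisfying _ 'I_q.+2 A; rewrite card_ord; apply=> C sCA.
  exact: (nbc_acyclic le_refl le_trans le_total nbcA sCA).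
(* Since the product is a positive power, [s] is nonzero, which bounds the exponent. *)
have leA : (#|A| <= k.+1)%N.
  rewrite -(@leq_exp2l q.+2) // -s_eq leq_pmull //.
  by rewrite lt0n; apply: contra_eq_neq s_eq => ->;
    rewrite mul0n eq_sym expn_eq0.
split=> //; apply/eqP; rewrite -(eqn_pmul2r (m := q.+2 ^ #|A|)) ?expn_gt0 //.
by rewrite s_eq -expnD subnK.
Qed.

Lemma nbc_polynomial :
  \sum_(A | nbc_set le A) (-1) ^+ #|A| *: 'X^(k.+1 - #|A|)
  = 'X * ('X - k.+1%:R%:P) ^+ k :> {poly int}.
Proof.
apply/eqP; rewrite -subr_eq0; set p := _ - _.
(* From [N] on, the modulus exceeds every possible circle gain, and the subtraction in [card_proper]
   is not truncated. The number of evaluation points is [size p], more than a nonzero [p] has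
   roots. *)
pose N := (#|{: shi_edge k.+1}| + k)%N.
pose rs : seq int := [seq (N + m).+2%:R | m <- iota 0 (size p)].
apply/eqP/(@roots_geq_poly_eq0 _ p rs); last by rewrite size_map size_iota.
  apply/allP => _ /mapP[m _ ->]; rewrite /root /p !hornerE horner_sum subr_eq0.
  have charR (z : int) : `|z| <= #|{: shi_edge k.+1}|%:R ->
      z%:~R = 0 :> 'I_(N + m).+2 -> z = 0.
    move=> le_z; apply: Zp_intr_eq0; apply: Order.POrderTheory.le_trans le_z _.
    by rewrite ler_nat /N; lia.
  have := whitney_broken_circuits le_refl le_anti le_trans le_total charR.
  rewrite card_proper -subSS natrM natrX natrB; last by rewrite /N; lia.
  move=> <-; apply/eqP/eq_bigr => A /nbc_card_satisfying-/(_ (N + m))[_ ->].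
  by rewrite !hornerE natrX.
rewrite map_inj_uniq ?iota_uniq // => m1 m2 /eqP.
by rewrite eqr_nat !eqSS eqn_add2l => /eqP.
Qed.

Theorem card_nbc : #|[set A | nbc_set le A]| = (k.+2 ^ k)%N.
Proof.
have := congr1 (horner^~ (-1)) nbc_polynomial; rewrite /= !hornerE horner_sum.
(* At -1 the sign of each term combines with the power of the variable into the same sign for every
   NBC set, so the sum counts them. *)
rewrite (eq_bigr (fun=> (-1) ^+ k.+1)) => [|A nbcA]; last first.
  have [leA _] := nbc_card_satisfying 0 nbcA.
  by rewrite !hornerE -exprD subnKC.
rewrite sumr_const -opprD [1 + _]addrC natr1.
rewrite [X in _ = -1 * X -> _]exprNn mulrA -exprS.
rewrite -[X in X = _ -> _]mulr_natr.
have sgn_neq0 : (-1) ^+ k.+1 != 0 :> int by rewrite signr_eq0.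
move/(mulfI sgn_neq0) => eq_nbc.
by apply/eqP; rewrite -(eqr_nat int) natrX -eq_nbc cardsE.
Qed.

End NBC.

Theorem corollary15 (n : nat) (n_gt0 : 0 < n)
    (le : rel (shi_edge n))
    (le_refl : reflexive le) (le_anti : antisymmetric le)
    (le_trans : transitive le) (le_total : total le) :
  exists f : {A : {set shi_edge n} | nbc_set le A} ->
             {T : {set {set 'I_n.+1}} | is_tree T},
    bijective f.
Proof.
have eq_card : #|{: {A : {set shi_edge n} | nbc_set le A}}|
             = #|{: {T : {set {set 'I_n.+1}} | is_tree T}}|.
  rewrite !card_sig -[LHS]cardsE -[RHS]cardsE cayley //.
  case: n n_gt0 le le_refl le_anti le_trans le_total => // k _ le *.
  exact: card_nbc.
(* The two sets have equal size, and elements of equal rank in their enumerations are matched. *)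
exists (fun A => enum_val (cast_ord eq_card (enum_rank A))).
exists (fun T => enum_val (cast_ord (esym eq_card) (enum_rank T))) => x.
  by rewrite enum_valK cast_ordK enum_rankK.
by rewrite enum_valK cast_ordKV enum_rankK.
Qed.
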